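(* Let $G$ be a finite group, let $I$ and $\Lambda$ be finite (non-empty) index sets, and let $P=(p_{\lambda i})$ be a regular $\Lambda\times I$ matrix with entries in $G^0$ that contains at least one zero entry. Let $\chi$ denote the chromatic number. (1) Suppose that $\mathcal{G}(\mathcal{M}_0[G;I,\Lambda;P])$ is connected. Let $c$ (respectively, $r$) be the maximum number of zeros in a column (respectively, row) of $P$. Then (a) if there exist $i\in I$ and $\lambda\in\Lambda$ such that $p_{\lambda i}\in G$, column $i$ of $P$ has $c$ zeros and row $\lambda$ of $P$ has $r$ zeros, then $\chi(\mathcal{G}(\mathcal{M}_0[G;I,\Lambda;P]))\leqslant cr|G|$; (b) otherwise, $\chi(\mathcal{G}(\mathcal{M}_0[G;I,\Lambda;P]))\leqslant(cr-1)|G|$. (2) Suppose that $\mathcal{G}(\mathcal{M}_0[G;I,\Lambda;P])$ is not connected. Let $A_1,\ldots,A_n$ be all the $0$-closure submatrices of $P$, with $A_l=P[\Lambda_l|I_l]$ for each $l\in\{1,\ldots,n\}$. For each $l$ let $c_l$ (respectively, $r_l$) be the maximum number of zeros in a column (respectively, row) of $A_l$, and define $z_l$ as follows: (a) if all entries of $A_l$ are $0$, or there exist $i\in I_l$ and $\lambda\in\Lambda_l$ such that $p_{\lambda i}\in G$, column $i$ of $A_l$ has $c_l$ zeros and row $\lambda$ of $A_l$ has $r_l$ zeros, then $z_l=c_lr_l$; (b) otherwise, $z_l=c_lr_l-1$. Then $\chi(\mathcal{G}(\mathcal{M}_0[G;I,\Lambda;P]))\leqslant\max\{2,z_1,\l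dots,z_n\}\,|G|$.
   Context: $G^0=G\cup\{0\}$ is $G$ with a zero adjoined. A matrix over $G^0$ is regular if every row and every column contains a non-zero entry. The $0$-Rees matrix semigroup $\mathcal{M}_0[G;I,\Lambda;P]$ is the set $(I\times G\times\Lambda)\cup\{0\}$ with $(i,x,\lambda)(j,y,\mu)=(i,xp_{\lambda j}y,\mu)$ if $p_{\lambda j}\neq 0$, $(i,x,\lambda)(j,y,\mu)=0$ if $p_{\lambda j}=0$, and all products involving $0$ equal to $0$. The commuting graph $\mathcal{G}(S)$ of a finite non-commutative semigroup $S$ is the simple graph with vertex set $S\setminus Z(S)$ ($Z(S)$ the center), where distinct $x,y$ are adjacent iff $xy=yx$. (When $P$ is regular and has a zero entry, $\mathcal{M}_0[G;I,\Lambda;P]$ is non-commutative with center $\{0\}$.) For $I'\subseteq I$, $\Lambda'\subseteq\Lambda$, $P[\Lambda'|I']$ is the submatrix of $P$ with rows indexed by $\Lambda'$ and columns by $I'$. $0$-closure method: let $p_{\lambda i}=0$. Put $I_0=\{i\}$, $\Lambda_0=\{\lambda\}$ and, for $k\ge 0$, $I_{k+1}=I_k\cup\{j\in I: p_{\mu j}=0\text{ for some }\mu\in\Lambda_k\}$ and $\Lambda_{k+1}=\Lambda_k\cup\{\mu\in\Lambda: p_{\mu j}=0\text{ for some }j\in I_k\}$. Let $\zeta(\lambda,i)$ be the least $k$ with $I_{k+1}=I_k$ and $\Lambda_{k+1}=\Lambda_k$. The $0$-closure $(\lambda,i)$-submatrix of $P$ is $P[\Lambda_k|I_k]$ with $k=\zeta(\lambda,i)$.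 A $0$-closure submatrix of $P$ is a $0$-closure $(\lambda,i)$-submatrix for some $(\lambda,i)$ with $p_{\lambda i}=0$; it is regarded as a submatrix together with its row and column index sets. (The sets $I_k,\Lambda_k$ in this paragraph are local to the method.) *)

(* Defs.v *)
From HB Require Import structures.
From mathcomp Require Import all_boot all_fingroup.

Set Implicit Arguments.
Unset Strict Implicit.
Unset Printing Implicit Defensive.

Record sgraph := SGraph {
  vertex :> finType;
  edge : rel vertex;
  edge_sym : symmetric edge;
  edge_irr : irreflexive edge
}.

Definition connected (H : sgraph) : bool :=
  [forall x : H, forall y : H, connect (@edge H) x y].

Definition proper_coloring (H : sgraph) k (f : {ffun H -> 'I_k}) : bool :=
  [forall x : H, forall y : H, edge x y ==> (f x != f y)].

Definition colorable (H : sgraph) k : bool :=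
  [exists f : {ffun H -> 'I_k}, proper_coloring f].

Fact colorable_exists (H : sgraph) : exists k, colorable H k.
Proof.
exists #|H|; apply/existsP; exists [ffun x => enum_rank x].
apply/'forall_forallP => x y; apply/implyP => exy; rewrite !ffunE.
by apply: contraTneq exy => /enum_rank_inj ->; rewrite edge_irr.
Qed.

Definition chromatic_number (H : sgraph) : nat := ex_minn (colorable_exists H).

Section CommutingGraph.
Variables (S : finType) (mul : SemiGroup.law S).

Definition center : {set S} := [set z | [forall x, mul z x == mul x z]].

Definition commuting_vertex : finType := {x : S | x \notin center}.

Definition commuting : rel commuting_vertex :=
  fun x y => (x != y) && (mul (val x) (val y) == mul (val y) (val x)).

Fact commuting_sym : symmetric commuting.
Proof. by move=> x y; rewrite /commuting eq_sym (eq_sym (mul _ _)). Qed.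

Fact commuting_irr : irreflexive commuting.
Proof. by move=> x; rewrite /commuting eqxx. Qed.

(* Usually considered for non-commutative S only; if S is commutative, this   *)
(* is the graph without vertices.                                             *)
Definition commuting_graph : sgraph := SGraph commuting_sym commuting_irr.

End CommutingGraph.

(* In all that follows, G^0 is option gT, with None as the adjoined zero; a   *)
(* Lambda x I matrix over G^0 is a function Lambda -> I -> option gT.         *)

Section Rees.
Variables (gT : finGroupType) (I Lambda : finType).
Variable P : Lambda -> I -> option gT.

Definition rees0 : finType := option (I * gT * Lambda).

Definition rees0_mul (u v : rees0) : rees0 :=
  match u, v with
  | Some (i, x, l), Some (j, y, m) =>
      if P l j is Some p then Some (i, (x * p * y)%g, m) else None
  | _, _ => None
  end.

Fact rees0_mulA : associative rees0_mul.
Proof.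
case=> [[[i x] l]|] [[[j y] m]|] [[[k z] n]|] //=; last by case: (P l j).
by case Plj: (P l j) => [p|]; case Pmk: (P m k) => [q|] //=;
  rewrite ?Plj ?Pmk ?mulgA.
Qed.

HB.instance Definition _ := SemiGroup.isLaw.Build rees0 rees0_mul rees0_mulA.

Definition regular_matrix : Prop :=
  (forall l, exists i, P l i <> None) /\ (forall i, exists l, P l i <> None).

(* P[Lambda'|I'] is represented by the pair (Lambda', I'). *)
Definition submatrix : Type := {set Lambda} * {set I}.

Definition whole_matrix : submatrix := (setT, setT).

Section Zeros.
Variable A : submatrix.

Definition col_zeros (i : I) : nat := #|[set l in A.1 | P l i == None]|.

Definition row_zeros (l : Lambda) : nat := #|[set i in A.2 | P l i == None]|.

Definition max_col_zeros : nat := \max_(i in A.2) col_zeros i.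

Definition max_row_zeros : nat := \max_(l in A.1) row_zeros l.

Definition nonzero_entry_at_max : bool :=
  [exists i in A.2, exists l in A.1,
    [&& P l i != None, col_zeros i == max_col_zeros
      & row_zeros l == max_row_zeros]].

Definition all_zero : bool :=
  [forall i in A.2, forall l in A.1, P l i == None].

(* For a 0-closure submatrix A, which contains a zero entry, the product of   *)
(* the two maxima is positive, so that the subtraction does not truncate.     *)
Definition z_bound : nat :=
  if all_zero || nonzero_entry_at_max then max_col_zeros * max_row_zeros
  else max_col_zeros * max_row_zeros - 1.

End Zeros.

Definition closure_step (A : submatrix) : submatrix :=
  (A.1 :|: [set m | [exists j in A.2, P m j == None]],
   A.2 :|: [set j | [exists m in A.1, P m j == None]]).

(* (Lambda_k, I_k) in the 0-closure method started at the entry (l, i). *)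
Definition closure_seq (l : Lambda) (i : I) (k : nat) : submatrix :=
  iter k closure_step ([set l], [set i]).

Fact closure_seq_stable l i :
  exists k, closure_seq l i k.+1 == closure_seq l i k.
Proof.
pose w (A : submatrix) := #|A.1| + #|A.2|.
have stepP A : closure_step A != A -> w A < w (closure_step A).
  case: A => B C; rewrite /closure_step /w /= => neq.
  set B' := _ :|: _ in neq *; set C' := C :|: _ in neq *.
  have sB : B \subset B' by apply: subsetUl.
  have sC : C \subset C' by apply: subsetUl.
  rewrite ltn_neqAle leq_add ?subset_leq_card // andbT.
  apply: contra neq => /eqP eqw.
  have eB : #|B'| <= #|B|.
    by rewrite -(leq_add2r #|C'|) -eqw leq_add2l subset_leq_card.
  have eC : #|C'| <= #|C|.
    by rewrite -(leq_add2l #|B'|) -eqw leq_add2r subset_leq_card.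
  have /eqP-> : B == B' by rewrite eqEcard sB.
  by have /eqP-> : C == C' by rewrite eqEcard sC.
have grow k : (exists k, closure_seq l i k.+1 == closure_seq l i k)
    \/ k <= w (closure_seq l i k).
  elim: k => [|k [?|IHk]]; [by right | by left |].
  have [e|ne] := boolP (closure_seq l i k.+1 == closure_seq l i k).
    by left; exists k.
  by right; apply: leq_ltn_trans IHk (stepP _ ne).
case: (grow (#|Lambda| + #|I|).+1) => //.
by move/leq_trans/(_ (leq_add (max_card _) (max_card _))); rewrite ltnn.
Qed.

Definition zeta (l : Lambda) (i : I) : nat := ex_minn (closure_seq_stable l i).

Definition zero_closure (l : Lambda) (i : I) : submatrix :=
  closure_seq l i (zeta l i).

Definition zero_closure_submatrices : {set submatrix} :=
  [set zero_closure l i | l in Lambda, i in I & P l i == None].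

End Rees.

(* Main.v *)
(* Colouring (i, x, l) by a pair consisting of x and a colour of the position *)
(* (i, l) reduces the problem to colouring the graph of positions, in which   *)
(* (i, l) and (j, m) are adjacent when P l j = P m i = 0. Positions lying in  *)
(* two different connected components of the bipartite graph of zeros only    *)
(* need two colours. Within a component, (i, l) has degree c_i * r_l, minus 1 *)
(* if P l i = 0, where c_i and r_l count the zeros of column i and of row l,  *)
(* and each position is connected to one with P l i = 0. Hence all degrees    *)
(* are at most the required number of colours, and each position is connected *)
(* to one of degree less than this number, so a greedy colouring succeeds.    *)
Require Import Defs.
From mathcomp Require Import all_boot all_fingroup.

Set Implicit Arguments.
Unset Strict Implicit.
Unset Printing Implicit Defensive.

(** Everything comes down to degrees in the graph of positions, since a colouring of positions with
    k colours yields one of the commuting graph with k times |G| colours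
    ([chromatic_number_positions]). [component_degree] bounds the degrees in one component of the
    zero graph. The delicate bound is cr - 1: with no non-zero entry at both maxima, non-zero
    positions have degree below cr and zero positions lose one by themselves; a zero of still
    smaller degree comes from [nonfull_zero]. A connected commuting graph makes the zero graph
    connected ([connected_zero_graph]), so that the whole matrix is its only component; in general,
    its components with an edge are the 0-closure submatrices ([connect_zero_closure]). *)

Section Coloring.
Variables (T : finType) (e : rel T).
Hypotheses (e_sym : symmetric e) (e_irr : irreflexive e).

(** * Greedy colouring of finite graphs *)

Definition degree (v : T) : nat := #|[set w | e v w]|.

(** Colour [D] without a vertex [v] of small degree first: the neighbours of [v] then use fewer than
    [k] colours, which leaves one for [v]. *)
Lemma degenerate_colorable k (D : {set T}) :
    (forall S : {set T}, S \subset D -> S != set0 ->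
      exists2 v, v \in S & #|[set w in S | e v w]| < k) ->
  exists f : T -> nat,
    {in D, forall x, f x < k} /\ {in D &, forall x y, e x y -> f x != f y}.
Proof.
move=> degen.
have [n] := ubnP #|D|; elim: n D degen => // n IHn D degen cardD.
have [->|D0] := eqVneq D set0.
  by exists (fun _ => 0); split=> x; rewrite inE.
have [v vD degv] := degen D (subxx D) D0.
have [S sSD|/=|f [f_lt f_proper]] := IHn (D :\ v).
- by apply: degen; apply: subset_trans sSD (subD1set D v).
- by move: cardD; rewrite (cardsD1 v) vD.
pose used := [seq f w | w <- enum [set w in D | e v w]].
have [c c_lt c_new] : exists2 c, c < k & c \notin used.
  have : has (fun c => c \notin used) (iota 0 k).
    apply: contraTT degv => /hasPn all_used.
    rewrite -leqNgt cardE -(size_map f) -[X in X <= _](size_iota 0).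
    by apply: uniq_leq_size (iota_uniq _ _) _ => c /all_used; rewrite negbK.
  by case/hasP=> c; rewrite mem_iota => c_lt c_new; exists c.
have c_neq w : w \in D -> e v w -> f w != c.
  move=> wD evw; apply: contraNneq c_new => <-.
  by rewrite map_f // mem_enum inE wD.
exists (fun x => if x == v then c else f x); split=> [x|x y] xD.
  by case: (eqVneq x v) => // xv; apply: f_lt; rewrite !inE xv.
move=> yD exy; case: (eqVneq x v) (eqVneq y v) => [xv|xv] [yv|yv].
- by rewrite xv yv e_irr in exy.
- by rewrite eq_sym c_neq // -xv.
- by rewrite c_neq // e_sym -yv.
- by apply: f_proper; rewrite // !inE ?xv ?yv.
Qed.

(* If every vertex of S had k neighbours in S, then S would contain all       *)
(* neighbours of its vertices, hence also a vertex of degree less than k.     *)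
Lemma connect_low_degree_colorable k (D : {set T}) :
    {in D, forall v, degree v <= k} ->
    {in D, forall v, exists2 w, connect e v w & degree w < k} ->
  exists f : T -> nat,
    {in D, forall x, f x < k} /\ {in D &, forall x y, e x y -> f x != f y}.
Proof.
move=> deg_le deg_lt; apply: degenerate_colorable => S sSD /set0Pn[v vS].
have [/exists_inP[u]|/exists_inPn S_high] :=
    boolP [exists u in S, #|[set w in S | e u w]| < k]; first by exists u.
have S_closed : closed e S.
  apply: (intro_closed (sym_connect_sym e_sym)) => x y exy xS.
  have: [set w in S | e x w] == [set w | e x w].
    rewrite eqEcard andbC (leq_trans (deg_le x (subsetP sSD x xS))) /=.
      by apply/subsetP => w; rewrite !inE => /andP[].
    by rewrite leqNgt S_high.
  by move/eqP/setP/(_ y); rewrite !inE exy andbT.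
have [w vw degw] := deg_lt v (subsetP sSD v vS).
have wS : w \in S by rewrite -(closed_connect S_closed vw).
exists w => //; apply: leq_ltn_trans degw; apply: subset_leq_card.
by apply/subsetP => z; rewrite !inE => /andP[].
Qed.

End Coloring.

Lemma chromatic_number_le (H : sgraph) (C : finType) (f : H -> C) :
  (forall x y : H, edge x y -> f x != f y) -> chromatic_number H <= #|C|.
Proof.
move=> f_proper; rewrite /chromatic_number; case: ex_minnP => m _; apply.
apply/existsP; exists [ffun x => enum_rank (f x)].
apply/'forall_forallP => x y; apply/implyP => exy; rewrite !ffunE.
by apply: contraNneq (f_proper _ _ exy) => /enum_rank_inj ->.
Qed.

(** * The zero graph and the graph of positions *)

Section Positions.
Variables (gT : finGroupType) (I Lambda : finType).
Variable P : Lambda -> I -> option gT.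

Definition zero (l : Lambda) (i : I) : bool := P l i == None.

(** The bipartite graph of columns and rows whose edges are the zeros of [P]; the 0-closure method
    is a search of one of its components. *)
Definition zero_graph : rel (I + Lambda) := fun x y =>
  match x, y with
  | inl i, inr l | inr l, inl i => zero l i
  | _, _ => false
  end.

Lemma zero_graph_sym : symmetric zero_graph.
Proof. by case=> [i|l] [j|m]. Qed.

Lemma connect_zero_sym : connect_sym zero_graph.
Proof. exact: sym_connect_sym zero_graph_sym. Qed.

Lemma connect_zero l i : zero l i -> connect zero_graph (inl i) (inr l).
Proof. by move=> z; apply: connect1. Qed.

(* Elements (i, x, l) and (j, y, m) of distinct positions commute iff both    *)
(* products vanish.                                                           *)
Definition position_adj : rel (I * Lambda) := fun u v =>
  [&& u != v, zero u.2 v.1 & zero v.2 u.1].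

Lemma position_adj_sym : symmetric position_adj.
Proof. by move=> u v; rewrite /position_adj eq_sym [X in _ && X]andbC. Qed.

Lemma position_adj_irr : irreflexive position_adj.
Proof. by move=> u; rewrite /position_adj eqxx. Qed.

Lemma connect_position u v :
  zero u.2 v.1 -> zero v.2 u.1 -> connect position_adj u v.
Proof.
have [-> _ _|uv zuv zvu] := eqVneq u v; first exact: connect0.
by apply: connect1; rewrite /position_adj uv zuv zvu.
Qed.

(** Equal products vanish together; if neither does, comparing the outer coordinates identifies the
    positions. *)
Lemma rees0_commute i x l j y m :
    rees0_mul P (Some (i, x, l)) (Some (j, y, m)) =
      rees0_mul P (Some (j, y, m)) (Some (i, x, l)) ->
  (i, l) = (j, m) \/ zero l j /\ zero m i.
Proof.
rewrite /zero /=; case Plj: (P l j) => [p|]; case Pmi: (P m i) => [q|] //.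
  by case=> -> _ ->; left.
by right.
Qed.

Lemma vertex_neq0 (s : commuting_graph (rees0_mul P)) : val s != None.
Proof.
case: s => -[s|] //=; rewrite inE => /negP[].
by apply/forallP => -[[[]]|].
Qed.

Lemma chromatic_number_positions k (f : I * Lambda -> nat) (v0 : I * Lambda) :
    (forall u, f u < k) -> (forall u v, position_adj u v -> f u != f v) ->
  chromatic_number (commuting_graph (rees0_mul P)) <= k * #|gT|.
Proof.
move=> f_lt f_proper.
(* The value at 0 is a dummy, as 0 is central and hence not a vertex; [v0] only serves to supply
   it. *)
pose g (s : rees0 gT I Lambda) :=
  if s is Some (i, x, l) then (Ordinal (f_lt (i, l)), x)
  else (Ordinal (f_lt v0), 1%g).
rewrite -[k]card_ord -card_prod.
apply: (chromatic_number_le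
  (f := fun s : commuting_graph (rees0_mul P) => g (val s))).
move=> s t /andP[]; rewrite -(inj_eq val_inj).
move: (vertex_neq0 s) (vertex_neq0 t).
case: (val s) (val t) => [[[i x] l]|] [[[j y] m]|] // _ _ st.
move=> /eqP /rees0_commute comm.
have [eq_pos|neq_pos] := eqVneq (i, l) (j, m).
  case: eq_pos st => -> -> /=.
  by apply: contraNneq => -[->].
case: comm => [/eqP|[zlj zmi]]; first by rewrite (negPf neq_pos).
rewrite /= xpair_eqE negb_and -val_eqE /= f_proper //.
by rewrite /position_adj neq_pos zlj zmi.
Qed.

(* Shortening a walk in the zero graph by one step at each end is a step in   *)
(* the graph of positions.                                                    *)
Lemma connect_zero_position i l :
    connect zero_graph (inl i) (inr l) ->
  exists2 v, connect position_adj (i, l) v & zero v.2 v.1.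
Proof.
case/connectP=> p zp /esym last_p; have [n] := ubnP (size p).
elim: n i l p zp last_p => // n IHn i l [|[//|m] p] //= /andP[zmi].
case/lastP: p => [_ [<-] _|p x]; first by exists (i, m).
rewrite rcons_path last_rcons => /andP[zp zx] xl.
case: p zp zx => [|y p] zp; rewrite xl //.
set q := y :: p in zp *; case last_q: (last (inr m) q) => [j|//] /= zlj size_q.
(* The walk is i, m, ..., j, l; its middle part, reversed, leads from j to m. *)
have [|||v jm_v zv] := IHn j m (rev (belast (inr m) q)).
- rewrite -last_q rev_path.
  by rewrite (eq_path (e' := zero_graph)) // => a b; rewrite zero_graph_sym.
- by rewrite /q /= rev_cons last_rcons.
- by move: size_q; rewrite size_rev size_belast size_rcons; apply: ltnW.
by exists v => //; apply: connect_trans jm_v; apply: connect_position.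
Qed.

(** * Degrees within one component of the zero graph *)

Section Component.
Variable A : submatrix I Lambda.
Hypothesis A_closed : forall l i, zero l i -> (l \in A.1) = (i \in A.2).
Hypothesis A_conn : forall i l,
  i \in A.2 -> l \in A.1 -> connect zero_graph (inl i) (inr l).

Let c := max_col_zeros P A.
Let r := max_row_zeros P A.
Let D := setX A.2 A.1.

Lemma col_zerosE i : i \in A.2 -> col_zeros P A i = #|[set l | zero l i]|.
Proof.
move=> iA; apply: eq_card => l; rewrite !inE andb_idl // => /A_closed.
by rewrite iA.
Qed.

Lemma row_zerosE l : l \in A.1 -> row_zeros P A l = #|[set i | zero l i]|.
Proof.
move=> lA; apply: eq_card => i; rewrite !inE andb_idl // => /A_closed.
by rewrite lA.
Qed.

Lemma col_zeros_le i : i \in A.2 -> col_zeros P A i <= c.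
Proof. by move=> iA; apply: leq_bigmax_cond. Qed.

Lemma row_zeros_le l : l \in A.1 -> row_zeros P A l <= r.
Proof. by move=> lA; apply: leq_bigmax_cond. Qed.

Lemma zeros_mul_le u :
  u \in D -> col_zeros P A u.1 * row_zeros P A u.2 <= c * r.
Proof.
by rewrite inE => /andP[u1 u2]; rewrite leq_mul ?col_zeros_le ?row_zeros_le.
Qed.

Lemma zeros_mul_gt0 l i : i \in A.2 -> l \in A.1 -> zero l i -> 0 < c * r.
Proof.
move=> iA lA zli; rewrite muln_gt0.
rewrite (leq_trans _ (col_zeros_le iA)) ?(leq_trans _ (row_zeros_le lA)) //.
  by rewrite row_zerosE //; apply/card_gt0P; exists i; rewrite inE.
by rewrite col_zerosE //; apply/card_gt0P; exists l; rewrite inE.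
Qed.

Lemma position_closed : closed position_adj D.
Proof.
move=> u v /and3P[_ zuv zvu].
by rewrite !inE (A_closed zuv) (A_closed zvu) andbC.
Qed.

(** The zeros of row [u.2] times the zeros of column [u.1] give the neighbours of [u], together with
    [u] itself exactly when [u] is a zero. *)
Lemma degree_position u : u \in D ->
  degree position_adj u + zero u.2 u.1 = col_zeros P A u.1 * row_zeros P A u.2.
Proof.
rewrite inE => /andP[u1 u2]; rewrite col_zerosE // row_zerosE // mulnC -cardsX.
rewrite (cardsD1 u (setX _ _)) inE /= !inE andbb addnC; congr (_ + _).
by apply: eq_card => v; rewrite !inE eq_sym.
Qed.

Lemma zeros_mul_max l i :
    i \in A.2 -> l \in A.1 -> 0 < c * r ->
    c * r <= col_zeros P A i * row_zeros P A l ->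
  col_zeros P A i = c /\ row_zeros P A l = r.
Proof.
move=> iA lA cr_gt0 cr_le; have i_le := col_zeros_le iA.
have l_le := row_zeros_le lA.
have := leq_trans cr_gt0 cr_le; rewrite muln_gt0 => /andP[i_gt0 l_gt0].
rewrite leqNgt in cr_le; split; apply/eqP; rewrite eqn_leq ?i_le ?l_le leqNgt.
  apply: contra cr_le => i_lt; apply: leq_trans (leq_mul (leqnn c) l_le).
  by rewrite ltn_pmul2r.
apply: contra cr_le => l_lt; apply: leq_trans (leq_mul i_le (leqnn r)).
by rewrite ltn_pmul2l.
Qed.

(* Call (i, l) full if column i has c zeros and row l has r zeros. If all     *)
(* neighbours of a full zero (i, l) were full, then the columns with a zero   *)
(* in row l would all have the zeros of column i, and dually, so that these   *)
(* rows and columns would exhaust A and A would be all zero.                  *)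
Lemma nonfull_zero l i :
    ~~ all_zero P A -> ~~ nonzero_entry_at_max P A ->
    i \in A.2 -> l \in A.1 -> zero l i ->
  exists v, [/\ connect position_adj (i, l) v, zero v.2 v.1 &
                col_zeros P A v.1 * row_zeros P A v.2 < c * r].
Proof.
move=> nA0 nAmax iA lA zli.
have [/exists_inP[[j m] jm jm_lt]|/exists_inPn full] := boolP [exists v in
    [set v | connect position_adj (i, l) v & zero v.2 v.1],
    col_zeros P A v.1 * row_zeros P A v.2 < c * r].
  by exists (j, m); move: jm; rewrite inE => /andP[].
have full_zero j m : connect position_adj (i, l) (j, m) -> zero m j ->
    [/\ j \in A.2, m \in A.1, col_zeros P A j = c & row_zeros P A m = r].
  move=> il_jm zmj; have := closed_connect position_closed il_jm.
  rewrite !inE iA lA => /esym/andP[jA mA].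
  have [|//] := @zeros_mul_max m j jA mA (zeros_mul_gt0 jA mA zmj).
  by rewrite leqNgt; apply: (full (j, m)); rewrite inE il_jm.
have [_ _ i_c l_r] := full_zero i l (connect0 _ _) zli.
have colP j : zero l j -> j \in A.2 /\ col_zeros P A j = c.
  move=> zlj; have il_jl := @connect_position (i, l) (j, l) zlj zli.
  by have [] := full_zero _ _ il_jl zlj.
have rowP m : zero m i -> m \in A.1 /\ row_zeros P A m = r.
  move=> zmi; have il_im := @connect_position (i, l) (i, m) zli zmi.
  by have [] := full_zero _ _ il_im zmi.
(* Otherwise (j, m) would be a non-zero entry at both maxima. *)
have rect j m : zero l j -> zero m i -> zero m j.
  move=> /colP[jA j_c] /rowP[mA m_r]; apply: contraNT nAmax => nz.
  apply/exists_inP; exists j => //; apply/exists_inP; exists m => //.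
  by rewrite nz j_c m_r !eqxx.
have col_sub j : zero l j -> [set m | zero m j] = [set m | zero m i].
  move=> zlj; have [jA j_c] := colP j zlj; apply/esym/eqP.
  rewrite eqEcard -!col_zerosE // i_c j_c leqnn andbT.
  by apply/subsetP => m; rewrite !inE; apply: rect.
have row_sub m : zero m i -> [set j | zero m j] = [set j | zero l j].
  move=> zmi; have [mA m_r] := rowP m zmi; apply/esym/eqP.
  rewrite eqEcard -!row_zerosE // l_r m_r leqnn andbT.
  by apply/subsetP => j; rewrite !inE => zlj; apply: rect.
(* The columns meeting row l in a zero and the rows meeting column i in a zero; being closed under
   adjacency, they include all of [A]. *)
pose a (x : I + Lambda) :=
  match x with inl j => zero l j | inr m => zero m i end.
have a_closed : closed zero_graph a.
  apply: (intro_closed connect_zero_sym); rewrite /in_mem /=.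
  case=> [j|m] [k|n] //= z.
    by move=> /col_sub/setP/(_ n); rewrite !inE z.
  by move=> /row_sub/setP/(_ k); rewrite !inE z.
case/negP: nA0; apply/forall_inP => j jA; apply/forall_inP => m mA.
have zmi : zero m i.
  rewrite -[zero m i]/(inr m \in a) -(closed_connect a_closed (A_conn iA mA)).
  exact: zli.
have zlj : zero l j.
  rewrite -[zero l j]/(inl j \in a) (closed_connect a_closed (A_conn jA mA)).
  exact: zmi.
exact: rect.
Qed.

Lemma component_degree u : u \in D ->
  degree position_adj u <= z_bound P A /\
  exists2 w, connect position_adj u w & degree position_adj w < z_bound P A.
Proof.
move=> uD; have := uD; rewrite inE => /andP[u1 u2].
have [w uw zw] : exists2 v, connect position_adj u v & zero v.2 v.1.
  by case: u u1 u2 {uD} => i l /= iA lA; apply/connect_zero_position/A_conn.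
have wD : w \in D by rewrite -(closed_connect position_closed uw).
have := wD; rewrite inE => /andP[w1 w2].
have cr_gt0 := zeros_mul_gt0 w1 w2 zw.
have deg_zero v : v \in D -> zero v.2 v.1 ->
    (degree position_adj v).+1 = col_zeros P A v.1 * row_zeros P A v.2.
  by move=> vD zv; rewrite -degree_position // zv addn1.
rewrite /z_bound -/c -/r; case: ifPn => [_|].
  split; last by exists w; rewrite // deg_zero // zeros_mul_le.
  by apply: leq_trans (zeros_mul_le uD); rewrite -degree_position // leq_addr.
rewrite negb_or subn1 => /andP[nA0 nAmax]; split.
  rewrite -ltnS prednK //; have [zu|nzu] := boolP (zero u.2 u.1).
    by rewrite deg_zero // zeros_mul_le.
  have := degree_position uD; rewrite (negPf nzu) addn0 => ->.
  (* A non-zero position reaching cr would be an entry at both maxima. *)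
  rewrite ltnNge; apply: contra nAmax => cr_le.
  have [u_c u_r] := zeros_mul_max u1 u2 cr_gt0 cr_le.
  apply/exists_inP; exists u.1 => //; apply/exists_inP; exists u.2 => //.
  by rewrite u_c u_r !eqxx !andbT.
have [v [wv zv v_lt]] := nonfull_zero nA0 nAmax w1 w2 zw.
rewrite -surjective_pairing in wv.
exists v; first exact: connect_trans wv.
by rewrite ltn_predRL deg_zero // -(closed_connect position_closed wv).
Qed.

End Component.

(** * 0-closure submatrices as components of the zero graph *)

Lemma closure_step_zero_closure l i :
  closure_step P (zero_closure P l i) = zero_closure P l i.
Proof.
by rewrite /zero_closure /zeta; case: ex_minnP => k /eqP.
Qed.

Lemma zero_closure_closed l i m j :
  zero m j -> (m \in (zero_closure P l i).1) = (j \in (zero_closure P l i).2).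
Proof.
set A := zero_closure P l i => zmj.
have [eq1 eq2] : A.1 = (closure_step P A).1 /\ A.2 = (closure_step P A).2.
  by rewrite closure_step_zero_closure.
apply/idP/idP => [mA|jA]; [rewrite eq2|rewrite eq1]; rewrite !inE.
  by apply/orP; right; apply/exists_inP; exists m.
by apply/orP; right; apply/exists_inP; exists j.
Qed.

Lemma mem_closure_seq l i k :
  l \in (closure_seq P l i k).1 /\ i \in (closure_seq P l i k).2.
Proof. by elim: k => [|k [IHl IHi]] /=; rewrite !inE ?eqxx ?IHl ?IHi. Qed.

Lemma connect_closure_seq l i k : zero l i ->
  {in (closure_seq P l i k).1, forall m, connect zero_graph (inl i) (inr m)} /\
  {in (closure_seq P l i k).2, forall j, connect zero_graph (inl i) (inl j)}.
Proof.
move=> zli; elim: k => [|k [IH1 IH2]] /=.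
  split=> x /set1P->; [exact: connect_zero|exact: connect0].
split=> x /setUP[]; [exact: IH1| |exact: IH2|]; rewrite inE.
  by case/exists_inP=> j /IH2 ij /connect_zero; apply: connect_trans ij.
case/exists_inP=> m /IH1 im zmx; apply: connect_trans im _.
by rewrite connect_zero_sym; apply: connect_zero.
Qed.

Lemma zero_closure_connected l i : zero l i ->
  forall j m, j \in (zero_closure P l i).2 -> m \in (zero_closure P l i).1 ->
  connect zero_graph (inl j) (inr m).
Proof.
move=> zli j m jA mA.
have [conn1 conn2] := connect_closure_seq (zeta P l i) zli.
by apply: connect_trans (conn1 m mA); rewrite connect_zero_sym; apply: conn2.
Qed.

(** The first edge of the walk is a zero in column i; the closure started there is closed under
    adjacency, so it follows the walk up to l. *)
Lemma connect_zero_closure i l : connect zero_graph (inl i) (inr l) ->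
  exists2 A, A \in zero_closure_submatrices P &
    [/\ i \in A.2, l \in A.1,
        forall m j, zero m j -> (m \in A.1) = (j \in A.2) &
        forall j m, j \in A.2 -> m \in A.1 ->
          connect zero_graph (inl j) (inr m)].
Proof.
move=> il; have [m zmi] : exists m, zero m i.
  by case/connectP: il => -[//|[j|m] p] /=; [|case/andP=> zmi _ _; exists m].
exists (zero_closure P m i); first by apply: imset2_f; rewrite ?inE.
have closedA := @zero_closure_closed m i.
have [_ iA] := mem_closure_seq m i (zeta P m i).
split=> //; last exact: zero_closure_connected.
pose a (x : I + Lambda) := match x with
  | inl j => j \in (zero_closure P m i).2
  | inr n => n \in (zero_closure P m i).1 end.
have a_closed : closed zero_graph a.
  by case=> [j|n] [k|p] // z; rewrite /in_mem /= (closedA _ _ z).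
by rewrite -[_ \in _]/(inr l \in a) -(closed_connect a_closed il).
Qed.

(** * Connectedness of the commuting graph *)

Lemma vertex_not_central i x l :
    regular_matrix P -> (exists l i, P l i = None) ->
  Some (i, x, l) \notin center (rees0_mul P).
Proof.
move=> [row_nz col_nz] [l0 [i0 P0]]; rewrite inE.
apply/negP => /forallP central.
(* With regularity, this forces [P] to be 1 x 1 with an entry both zero and non-zero. *)
have pos j m : ~~ zero l j || ~~ zero m i -> (i, l) = (j, m).
  move=> nz; have /eqP/rees0_commute[//|[z1 z2]] := central (Some (j, 1%g, m)).
  by rewrite z1 z2 in nz.
have [j /eqP lj] := row_nz l; have [m /eqP mi] := col_nz i.
have rowE n : n = l.
  by have /pos[_ ->] : ~~ zero l j || ~~ zero n i by rewrite /zero lj.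
have colE k : k = i.
  by have /pos[->] : ~~ zero l k || ~~ zero m i by rewrite /zero mi orbT.
by move: mi; rewrite (rowE m) -(rowE l0) -(colE i0) P0.
Qed.

(** Whether i and l lie in the same component is invariant along edges of the commuting graph, and
    it holds at a zero of [P]. *)
Lemma connected_zero_graph i l :
    regular_matrix P -> (exists l i, P l i = None) ->
    connected (commuting_graph (rees0_mul P)) ->
  connect zero_graph (inl i) (inr l).
Proof.
move=> regP exP conn; have [l0 [i0 P0]] := exP.
pose vert j m : commuting_graph (rees0_mul P) :=
  Sub (Some (j, 1%g, m)) (vertex_not_central j 1%g m regP exP).
pose a (s : commuting_graph (rees0_mul P)) :=
  if val s is Some (j, _, m) then connect zero_graph (inl j) (inr m) else true.
have a_closed : closed (@edge (commuting_graph (rees0_mul P))) a.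
  apply: (intro_closed (sym_connect_sym (@edge_sym _))) => s t.
  case/andP=> _ /eqP; rewrite /in_mem /= /a /=.
  move: (vertex_neq0 s) (vertex_neq0 t) => /=.
  case: (sval s) (sval t) => [[[j x] m]|] [[[k y] n]|] // _ _.
  case/rees0_commute=> [[-> ->]//|[zmk znj]] jm.
  apply: connect_trans (connect_zero zmk) _; rewrite connect_zero_sym in jm.
  exact: connect_trans jm (connect_zero znj).
have /forallP/(_ (vert i0 l0))/forallP/(_ (vert i l)) := conn.
move/(closed_connect a_closed); rewrite /in_mem /= /a /= => <-.
by apply: connect_zero; rewrite /zero P0.
Qed.

(** * The two colouring bounds *)

Lemma chromatic_number_connected (v0 : I * Lambda) :
    (forall i l, connect zero_graph (inl i) (inr l)) ->
  chromatic_number (commuting_graph (rees0_mul P)) <=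
    z_bound P (whole_matrix I Lambda) * #|gT|.
Proof.
move=> conn; pose W := whole_matrix I Lambda.
have degW u := @component_degree W _ (fun i l _ _ => conn i l) u.
have uW u : u \in setX W.2 W.1 by rewrite !inE.
have [||f [f_lt f_proper]] := connect_low_degree_colorable
    position_adj_sym position_adj_irr (D := setX W.2 W.1) (k := z_bound P W).
- by move=> u /degW[] // l i; rewrite !inE.
- by move=> u /degW[] // l i; rewrite !inE.
apply: (chromatic_number_positions v0) => [u|u v]; first exact: f_lt.
exact: f_proper.
Qed.

(* Positions (i, l) with i and l in distinct components of the zero graph     *)
(* induce a bipartite graph: adjacent ones join the same two components in    *)
(* opposite orders.                                                           *)
Lemma chromatic_number_components (v0 : I * Lambda) :
  chromatic_number (commuting_graph (rees0_mul P)) <=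
    maxn 2 (\max_(A in zero_closure_submatrices P) z_bound P A) * #|gT|.
Proof.
set K := maxn _ _.
pose D := [set u : I * Lambda | connect zero_graph (inl u.1) (inr u.2)].
have degD u : u \in D -> degree position_adj u <= K /\
    exists2 w, connect position_adj u w & degree position_adj w < K.
  rewrite inE => /connect_zero_closure[A A_cl [u1 u2 A_closed A_conn]].
  have A_K : z_bound P A <= K.
    by rewrite leq_max (leq_bigmax_cond _ A_cl) orbT.
  have [|deg_u [w uw deg_w]] := component_degree A_closed A_conn (u := u).
    by rewrite inE u1.
  by split; [|exists w]; rewrite // (leq_trans _ A_K).
have [||f [f_lt f_proper]] := connect_low_degree_colorable
    position_adj_sym position_adj_irr (D := D) (k := K).
- by move=> u /degD[].
- by move=> u /degD[].
pose comp x := enum_rank (root zero_graph x).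
pose side (u : I * Lambda) : nat := comp (inl u.1) < comp (inr u.2).
apply: (chromatic_number_positions v0
  (f := fun u => if u \in D then f u else side u)).
  move=> u; case: ifP => [/f_lt//|_]; apply: leq_trans (leq_maxl _ _).
  by rewrite ltnS leq_b1.
move=> u v uv; have /and3P[_ /connect_zero zuv /connect_zero zvu] := uv.
have rootE := rootP connect_zero_sym.
have comp_uv : comp (inl v.1) = comp (inr u.2) by rewrite /comp (rootE _ _ zuv).
have comp_vu : comp (inl u.1) = comp (inr v.2) by rewrite /comp (rootE _ _ zvu).
have DE w : (w \in D) = (comp (inl w.1) == comp (inr w.2)).
  by rewrite inE -(root_connect connect_zero_sym) (inj_eq enum_rank_inj).
(* No edge leaves [D], so the colourings of [D] and of its complement may share colours. *)
have Duv : (v \in D) = (u \in D) by rewrite !DE comp_uv comp_vu eq_sym.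
rewrite Duv; case: ifP => [uD|/negbT]; first by apply: f_proper; rewrite ?Duv.
by rewrite DE /side comp_uv comp_vu -val_eqE /=; case: ltngtP.
Qed.

End Positions.

Theorem theorem7p6 (gT : finGroupType) (I Lambda : finType)
    (P : Lambda -> I -> option gT) :
  regular_matrix P ->
  (exists l i, P l i = None) ->
  let GM := commuting_graph (rees0_mul P) in
  (connected GM ->
     let c := max_col_zeros P (whole_matrix I Lambda) in
     let r := max_row_zeros P (whole_matrix I Lambda) in
     ((exists i l, [/\ P l i <> None,
                       col_zeros P (whole_matrix I Lambda) i = c &
                       row_zeros P (whole_matrix I Lambda) l = r]) ->
        chromatic_number GM <= c * r * #|gT|) /\
     (~ (exists i l, [/\ P l i <> None,
                         col_zeros P (whole_matrix I Lambda) i = c &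
                         row_zeros P (whole_matrix I Lambda) l = r]) ->
        chromatic_number GM <= (c * r - 1) * #|gT|)) /\
  (~ connected GM ->
     chromatic_number GM <=
       maxn 2 (\max_(A in zero_closure_submatrices P) z_bound P A) * #|gT|).
Proof.
move=> regP exP GM; have [l0 [i0 _]] := exP.
split=> [conn c r|_]; last exact: chromatic_number_components (i0, l0).
have nz_atP : reflect (exists i l, [/\ P l i <> None,
      col_zeros P (whole_matrix I Lambda) i = c &
      row_zeros P (whole_matrix I Lambda) l = r])
    (nonzero_entry_at_max P (whole_matrix I Lambda)).
  apply: (iffP exists_inP) => [[i _ /exists_inP[l _]]|[i [l [nz ic lr]]]].
    by case/and3P=> /eqP nz /eqP ic /eqP lr; exists i, l.
  exists i; rewrite ?inE //; apply/exists_inP; exists l; rewrite ?inE //.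
  by rewrite ic lr !eqxx !andbT; apply/eqP.
(* Regularity rules out the all-zero case, so [z_bound] distinguishes exactly (a) and (b). *)
have nA0 : all_zero P (whole_matrix I Lambda) = false.
  apply/negP => /forall_inP/(_ i0 (in_setT _))/forall_inP all0.
  by have [l nz] := regP.2 i0; case: nz; apply/eqP/all0; rewrite inE.
have := chromatic_number_connected (i0, l0)
  (fun i l => connected_zero_graph i l regP exP conn).
by rewrite /z_bound nA0 /=; case: nz_atP.
Qed.
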